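(* Consider the system of ODEs $\partial_t u=Lu$ that represents the domain-of-dependence (DoD) stabilized semidiscretization described in the context, treated exactly or by under-integration with Gauss-Lobatto-Legendre quadrature. There is a constant $C$, depending only on the polynomial degree $p$ and the chosen basis/nodes, such that $$\|Lu\|_M\le \frac{C a}{\Delta x}\,\|u\|_M ,$$ i.e., by applying the DoD stabilization, the operator norm $\|L\|_M$ does not scale with the inverse $\alpha^{-1}$ of the small cut-cell size, as it would without that stabilization.
   Context: Problem: the linear advection equation $\partial_t u+a\,\partial_x u=0$, $a>0$, on $\Omega=(x_L,x_R)$ with periodic boundary conditions. Mesh: vertices $x_0<x_1<\dots<x_N$ of $\Omega$, cells $E_i=(x_{i-1},x_i)$ with sizes $\Delta x_i=|E_i|$, and an index $c$ such that $\Delta x_i=\Delta x$ (the background cell size) for $i\notin\{c,c+1\}$, $\Delta x_c=\alpha\Delta x$ and $\Delta x_{c+1}=(1-\alpha)\Delta x$, where $\alpha\in(0,1/2]$ is the cut-cell factor; $E_c$ may be an arbitrarily small cut cell. Cell indices are understood periodically. Discrete space: $\mathcal{V}_h^p(\Omega)=\{v\in L^2(\Omega): v|_{E_i}$ is a polynomial of degree at most $p$, $i=1,\dots,N\}$. The jump at $x_i$ is $\llbracket v\rrbracket_i=v|_{E_i}(x_i)-v|_{E_{i+1}}(x_i)$. Discrete inner product and norm: let $\tilde x_0,\dots,\tilde x_p\in[-1,1]$ be the Gauss-Legendre or Gauss-Lobatto-Legendre nodes and $\omega_0,\dots,\omega_p$ the corresponding quadrature weights. With $x_{ik}=\frac{x_{i-1}+x_i}{2}+\frac{\Delta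 x_i}{2}\tilde x_k$ set $$(u,v)_M=\sum_{i=1}^N\frac{\Delta x_i}{2}\sum_{k=0}^p\omega_k\,u|_{E_i}(x_{ik})\,v|_{E_i}(x_{ik}),\qquad \|u\|_M=\sqrt{(u,u)_M}.$$ For Gauss-Legendre nodes this is the exact $L^2(\Omega)$ inner product on $\mathcal{V}_h^p(\Omega)$; for Gauss-Lobatto-Legendre nodes the mass matrix is under-integrated. $\|L\|_M$ is the operator norm induced by $\|\cdot\|_M$. Background (upwind discontinuous Galerkin) bilinear form: $$a_h(u,v)=-\sum_{i=1}^N a\int_{x_{i-1}}^{x_i}u\,\partial_x v\,dx+\sum_{i=1}^N a\,u|_{E_i}(x_i)\,\llbracket v\rrbracket_i .$$ DoD stabilization: for a cell $E$ and $u\in\mathcal{V}_h^p(\Omega)$, let $\mathcal{L}_E(u)$ be the polynomial of degree at most $p$ on all of $\Omega$ that coincides with $u$ on $E$. Let $\eta_c=1-\min\{1,\alpha/\lambda_c\}$, where $\lambda_c>0$ is the parameter of the stabilization (for example $\lambda_c=1$, or $\lambda_c=a\Delta t/\Delta x$ with the time step $\Delta t$), and let $J_h=J_h^0+J_h^1$ with $$J_h^0(u,v)=\eta_c\,a\,\bigl(\mathcal{L}_{E_{c-1}}(u)(x_c)-u|_{E_c}(x_c)\bigr)\llbracket v\rrbracket_c,$$ $$J_h^1(u,v)=\eta_c\int_{x_{c-1}}^{x_c}a\,\bigl(\mathcal{L}_{E_{c-1}}(u)-u\bigr)\,\partial_x\bigl(\mathcal{L}_{E_{c-1}}(v)-v\bigr)\,dx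 .$$ Operator $L$: the linear operator on $\mathcal{V}_h^p(\Omega)$ defined by $$(Lu,v)_M=-a_h(u,v)-J_h(u,v)\qquad\text{for all }u,v\in\mathcal{V}_h^p(\Omega).$$ (The integrands in $a_h$ and $J_h$ have degree at most $2p-1$ on each cell, so both quadratures evaluate them exactly.) Identifying $u$ with its vector of nodal values in $\mathbb{R}^{(p+1)N}$, $L$ is a matrix in $\mathbb{R}^{(p+1)N\times(p+1)N}$. The unstabilized scheme is the one with $J_h$ omitted.
   Formalization: The constant C also depends on a lower bound λ₀ > 0 for the parameter λ_c, and holds uniformly for all λ_c ≥ λ₀; for arbitrary λ_c > 0 no uniform C exists, since λ_c ≤ α gives η_c = 0 and J_h = 0. *)

(* Defs.v *)
From HB Require Import structures.
From mathcomp Require Import all_boot all_order all_algebra.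
From mathcomp Require Import all_classical all_reals all_analysis.

Set Implicit Arguments.
Unset Strict Implicit.
Unset Printing Implicit Defensive.

Import Order.TTheory GRing.Theory Num.Theory.
Import numFieldNormedType.Exports.

Local Open Scope classical_set_scope.
Local Open Scope ring_scope.

Definition integ (R : realType) (lo hi : R) (f : R -> R) : R :=
  (\int[@lebesgue_measure R]_(y in `[lo, hi]) f y)%R.

(* Legendre polynomial of degree n, by Rodrigues' formula. *)
Definition legendre (R : realType) (n : nat) : {poly R} :=
  (2 ^+ n * n`!%:R)^-1 *: (('X^2 - 1) ^+ n)^`(n).

(* Nodes are a function on nat (as in the library's Lagrange basis), of which
   only the values at 0, ..., p matter.  A strictly increasing sequence of p + 1
   roots of a polynomial of degree p + 1 lists all of its roots. *)
Definition gauss_legendre_nodes (R : realType) (p : nat) (xt : nat -> R) : Prop :=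
  (forall i j : nat, (i < j <= p)%N -> xt i < xt j) /\
  (forall k : nat, (k <= p)%N -> root (legendre R p.+1) (xt k)).

Definition gauss_lobatto_nodes (R : realType) (p : nat) (xt : nat -> R) : Prop :=
  [/\ (0 < p)%N,
      (forall i j : nat, (i < j <= p)%N -> xt i < xt j),
      xt 0%N = -1, xt p = 1
    & forall k : nat, (0 < k < p)%N -> root ((legendre R p)^`()) (xt k)].

(* Weight of node k: integral over [-1, 1] of the k-th Lagrange polynomial. *)
Definition quad_weight (R : realType) (p : nat) (xt : nat -> R) (k : 'I_p.+1) : R :=
  integ (-1) 1 (fun y => (tnth (lagrange p.+1 xt) k : {poly R}).[y]).

(* Cells are indexed by i : 'I_N from 0; cell i is (x i, x i.+1).  Only the
   vertices x 0, ..., x N matter.  Neighbouring cells are taken cyclically: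
   ordS i is the right neighbour of i and ord_pred i the left one. *)
Definition cell_size (R : realType) (x : nat -> R) (i : nat) : R := x i.+1 - x i.

(* 1 < N says that c and its right neighbour are two different cells. *)
Definition cut_cell_mesh (R : realType) (N : nat) (x : nat -> R) (c : 'I_N)
    (dx alpha : R) : Prop :=
  [/\ (1 < N)%N,
      forall i : 'I_N, x i < x i.+1,
      0 < alpha <= 2^-1,
      forall i : 'I_N, i != c -> i != ordS c -> cell_size x i = dx
    & cell_size x c = alpha * dx /\ cell_size x (ordS c) = (1 - alpha) * dx].

(* Broken polynomials of degree at most p: v i is the restriction of v to cell
   i, as a polynomial in the global coordinate. *)
Notation dg_space R p N := ({ffun 'I_N -> {poly_(p.+1) R}}).

Section Forms.
Variables (R : realType) (p N : nat) (x : nat -> R).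
Implicit Types u v : dg_space R p N.

Definition quad_point (xt : nat -> R) (i k : nat) : R :=
  (x i + x i.+1) / 2 + cell_size x i / 2 * xt k.

Definition innerM (xt : nat -> R) u v : R :=
  \sum_(i < N) cell_size x i / 2 *
    \sum_(k < p.+1) quad_weight xt k *
      (u i).[quad_point xt i k] * (v i).[quad_point xt i k].

Definition normM (xt : nat -> R) u : R := Num.sqrt (innerM xt u u).

(* Operator norm induced by normM, in the extended reals. *)
Definition opnormM (xt : nat -> R) (L : dg_space R p N -> dg_space R p N) : \bar R :=
  ereal_sup [set (normM xt (L u))%:E | u in [set u | normM xt u <= 1]].

(* Jump at the right vertex of cell i; at x N the right trace is taken at x 0. *)
Definition jump v (i : 'I_N) : R := (v i).[x i.+1] - (v (ordS i)).[x (ordS i)].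

Definition a_h (a : R) u v : R :=
  - (\sum_(i < N) a * integ (x i) (x i.+1) (fun y => (u i).[y] * (v i)^`().[y]))
  + \sum_(i < N) a * (u i).[x i.+1] * jump v i.

(* The extension of u from the left neighbour of c, in the coordinate of cell c.
   The shift is 0 unless c = 0; then it is the period x N - x 0, since
   the left neighbour of the first cell is the last one. *)
Definition extension (c : 'I_N) u : {poly R} :=
  u (ord_pred c) \Po ('X + (x (ord_pred c).+1 - x c)%:P).

Definition dod_eta (alpha lambda : R) : R := 1 - Num.min 1 (alpha / lambda).

Definition J_h0 (c : 'I_N) (a alpha lambda : R) u v : R :=
  dod_eta alpha lambda * a * ((extension c u).[x c.+1] - (u c).[x c.+1]) * jump v c.

Definition J_h1 (c : 'I_N) (a alpha lambda : R) u v : R :=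
  dod_eta alpha lambda *
  integ (x c) (x c.+1) (fun y =>
    a * ((extension c u).[y] - (u c).[y]) *
    (extension c v - (v c : {poly R}))^`().[y]).

Definition J_h (c : 'I_N) (a alpha lambda : R) u v : R :=
  J_h0 c a alpha lambda u v + J_h1 c a alpha lambda u v.

Definition is_dod_operator (xt : nat -> R) (c : 'I_N) (a alpha lambda : R)
    (L : {linear dg_space R p N -> dg_space R p N}) : Prop :=
  forall u v, innerM xt (L u) v = - a_h a u v - J_h c a alpha lambda u v.

Definition is_unstabilized_operator (xt : nat -> R) (a : R)
    (L : {linear dg_space R p N -> dg_space R p N}) : Prop :=
  forall u v, innerM xt (L u) v = - a_h a u v.

End Forms.

(* Main.v *)
Require Import Defs.
From HB Require Import structures.
From mathcomp Require Import all_boot all_order all_algebra.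
From mathcomp Require Import all_classical all_reals all_analysis.
From mathcomp Require Import ring lra zify.
From mathcomp Require polyorder polyrcf cauchyreals.
Set Implicit Arguments.
Unset Strict Implicit.
Unset Printing Implicit Defensive.
Import Order.TTheory GRing.Theory Num.Theory.
Import numFieldNormedType.Exports.
Local Open Scope classical_set_scope.
Local Open Scope ring_scope.

(** Both estimates concern the bilinear form that represents the operator:
    testing with v = L u turns |(L u, v)| <= M |u| |v| into |L u| <= M |u|
    ([operator_bound]), while |(L e, e)| <= |L e| |e| gives lower bounds.

    All of this requires normM to be a norm, hence positive quadrature weights.
    Both quadratures are exact far enough because the polynomial that vanishes at
    the nodes is orthogonal to low degrees ([legendre_orth],
    [legendre_deriv_orth], [quad_exact]); integrating a nonnegative polynomial
    that vanishes at all nodes but one then shows that its weight is positive.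

    Write n_i for the nodal norm of u on cell i, without the factor h_i / 2, so
    that |u|^2 is the sum of h_i / 2 * n_i^2.  By interpolation on the reference
    interval and scaling, values of u near cell i are at most K n_i, and
    derivatives at most K n_i / h_i, with K depending on p and the nodes only
    ([cell_eval_bound]).  Every term of the background form that involves cell i
    is thus of order a n_i m_i or a n_i m_(i+1), where m belongs to the test
    function.  On a large cell n_i is of order |u| / sqrt dx, which gives the
    wanted a / dx; on the cut cell n_c can be as large as |u| / sqrt (alpha dx),
    and this is where 1 / alpha comes from: the indicator of the cut cell
    realizes it ([a_h_cut_indicator]).

    With the stabilization, the terms around the cut cell are the convex
    combination, with weights 1 - eta and eta, of the background terms and of the
    terms stabilized at full strength.  The weight 1 - eta is at most
    alpha / lambda0 and compensates the two factors 1 / sqrt alpha.  At full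
    strength, integration by parts on the cut cell cancels all traces of the
    cut-cell values ([stabilized_cut_flux]); what remains, besides terms on the
    two large neighbours, are integrals over the cut cell, of length alpha dx,
    that contain the derivative of an extension from the left neighbour, of
    order n_(c-1) / dx.  They gain a factor alpha as well ([full_stabilization_le], [cut_flux_le]). *)

(** * Integrals of polynomials over an interval *)

Section PolyIntegral.
Variable R : realType.
Implicit Types (lo hi : R) (f g : {poly R}).

Definition pint lo hi f : R := integ lo hi (horner f).

Lemma poly_antiderivative f : exists F : {poly R}, F^`() = f.
Proof.
exists (\poly_(i < (size f).+1) (f`_i.-1 / i%:R)).
apply/polyP=> i; rewrite coef_deriv coef_poly ltnS.
case: ltnP => [_|ge_i]; last by rewrite mul0rn nth_default.
by rewrite -(mulr_natr (_ / _)) -mulrA mulVf ?mulr1 // pnatr_eq0.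
Qed.

Lemma pint_deriv lo hi f : lo < hi -> pint lo hi f^`() = f.[hi] - f.[lo].
Proof.
move=> lt_lohi; rewrite /pint /integ /Rintegral.
rewrite (@continuous_FTC2 _ _ (horner f))//.
- by apply: continuous_in_subspaceT => x _; exact: continuous_horner.
- split=> [x _||]; first exact: derivable_horner.
  + by apply: cvg_at_right_filter; exact: continuous_horner.
  + by apply: cvg_at_left_filter; exact: continuous_horner.
- by move=> x _; rewrite -derivE.
Qed.

Lemma pintD lo hi f g : lo < hi ->
  pint lo hi (f + g) = pint lo hi f + pint lo hi g.
Proof.
move=> lt_lohi.
have [F <-] := poly_antiderivative f; have [G <-] := poly_antiderivative g.
by rewrite -derivD !pint_deriv // !hornerD; ring.
Qed.

Lemma pintN lo hi f : lo < hi -> pint lo hi (- f) = - pint lo hi f.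
Proof.
move=> lt_lohi; have [F <-] := poly_antiderivative f.
by rewrite -derivN !pint_deriv // !hornerN; ring.
Qed.

Lemma pintB lo hi f g : lo < hi ->
  pint lo hi (f - g) = pint lo hi f - pint lo hi g.
Proof. by move=> lt_lohi; rewrite pintD // pintN. Qed.

Lemma pintZ lo hi (k : R) f : lo < hi -> pint lo hi (k *: f) = k * pint lo hi f.
Proof.
move=> lt_lohi; have [F <-] := poly_antiderivative f.
by rewrite -derivZ !pint_deriv // !hornerZ; ring.
Qed.

Lemma pint0 lo hi : lo < hi -> pint lo hi 0 = 0.
Proof. by move=> lt_lohi; rewrite -(scale0r 0) pintZ // mul0r. Qed.

Lemma pint_sum lo hi (I : Type) (r : seq I) (F : I -> {poly R}) : lo < hi ->
  pint lo hi (\sum_(i <- r) F i) = \sum_(i <- r) pint lo hi (F i).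
Proof.
move=> lt_lohi; elim: r => [|i r IHr]; first by rewrite !big_nil pint0.
by rewrite !big_cons pintD // IHr.
Qed.

Lemma pint_by_parts lo hi f g : lo < hi ->
  pint lo hi (f^`() * g) =
  f.[hi] * g.[hi] - f.[lo] * g.[lo] - pint lo hi (f * g^`()).
Proof.
move=> lt_lohi; rewrite -!hornerM -pint_deriv // derivM pintD //; ring.
Qed.

Lemma pint_mean lo hi f : lo < hi ->
  exists2 y, lo <= y <= hi & pint lo hi f = f.[y] * (hi - lo).
Proof.
move=> lt_lohi; have [F <-] := poly_antiderivative f.
have [y /[!in_itv]/= /andP[loy yhi] eF] := polyrcf.poly_mvt F lt_lohi.
by exists y; rewrite ?(ltW loy) ?ltW // pint_deriv.
Qed.

Lemma norm_pint_le lo hi f (B : R) : lo < hi ->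
  (forall y, lo <= y <= hi -> `|f.[y]| <= B) ->
  `|pint lo hi f| <= B * (hi - lo).
Proof.
move=> lt_lohi leB; have [y y_in ->] := pint_mean f lt_lohi.
by rewrite normrM [`|hi - lo|]gtr0_norm ?subr_gt0 // ler_pM2r ?subr_gt0 ?leB.
Qed.

(** A primitive of f is nondecreasing; if it took equal values at both ends it
    would be constant on the interval, hence constant as a polynomial. *)
Lemma pint_gt0 lo hi f : lo < hi -> f != 0 ->
  (forall y, lo <= y <= hi -> 0 <= f.[y]) -> 0 < pint lo hi f.
Proof.
move=> lt_lohi f_neq0 f_ge0.
have pint_ge0 a b : lo <= a -> b <= hi -> a < b -> 0 <= pint a b f.
  move=> loa bhi lt_ab; have [y /andP[ay yb] ->] := pint_mean f lt_ab.
  rewrite mulr_ge0 ?subr_ge0 ?(ltW lt_ab) // f_ge0 //.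
  by rewrite (le_trans loa ay) (le_trans yb bhi).
rewrite lt_def pint_ge0 // andbT; apply: contra f_neq0 => /eqP int0.
have [F eF] := poly_antiderivative f.
pose node (k : nat) : R := lo + (hi - lo) / k.+2%:R.
have node_inj : injective node.
  have d_neq0 : hi - lo != 0 by rewrite subr_eq0 gt_eqF.
  by move=> i j /addrI/(mulfI d_neq0)/invr_inj/eqP; rewrite eqr_nat => /eqP[].
have Fnode k : F.[node k] = F.[lo].
  have k2_gt1 : 1 < k.+2%:R :> R by rewrite ltr1n.
  have loN : lo < node k.
    by rewrite ltrDl divr_gt0 ?subr_gt0 // (lt_trans ltr01).
  have Nhi : node k < hi.
    rewrite -ltrBrDl ltr_pdivrMr ?(lt_trans ltr01)//.
    by rewrite ltr_pMr // subr_gt0.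
  have := pint_ge0 _ _ (lexx lo) (ltW Nhi) loN.
  have := pint_ge0 _ _ (ltW loN) (lexx hi) Nhi.
  move: int0; rewrite -eF !pint_deriv //; lra.
suff: F - F.[lo]%:P = 0.
  by move/(congr1 deriv)/eqP; rewrite derivB derivC subr0 deriv0 eF.
apply/eqP; apply: contraT => G_neq0.
have := max_poly_roots G_neq0 (rs := map node (iota 0 (size (F - F.[lo]%:P)))).
rewrite size_map size_iota ltnn map_inj_uniq // iota_uniq; apply => //.
by apply/allP => _ /mapP[k _ ->]; rewrite rootE !hornerE Fnode subrr.
Qed.

End PolyIntegral.

(** * Legendre polynomials *)

Section Legendre.
Variable R : realType.
Implicit Types (f g q : {poly R}).

Lemma ltN11R : -1 < 1 :> R. Proof. by lra. Qed.

Lemma size_sqrX_sub1 : size ('X^2 - 1 : {poly R}) = 3.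
Proof. by rewrite -(polyC1 R) size_XnsubC. Qed.

Lemma sqrX_sub1_end (y : R) : y ^+ 2 = 1 -> ('X^2 - 1 : {poly R}).[y] = 0.
Proof. by move=> y2; rewrite !hornerE y2 subrr. Qed.

(** Integrating by parts n times moves all derivatives onto q, which they
    annihilate. *)
Lemma pint_derivn_orth lo hi n f q : lo < hi ->
  (forall j, (j < n)%N -> f^`(j).[lo] = 0 /\ f^`(j).[hi] = 0) ->
  (size q <= n)%N -> pint lo hi (f^`(n) * q) = 0.
Proof.
move=> lt_lohi; elim: n q => [|n IHn] q f0 szq.
  by move: szq; rewrite size_poly_leq0 => /eqP->; rewrite mulr0 pint0.
have [flo fhi] := f0 n (ltnSn n).
rewrite derivnS pint_by_parts // flo fhi !mul0r subrr IHn ?subrr //.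
  by move=> j ltjn; apply: f0; rewrite ltnW.
by rewrite polyorder.size_deriv; case: (size q) szq.
Qed.

Lemma derivn_exp_dvd f n j : (j <= n)%N ->
  exists g, (f ^+ n)^`(j) = f ^+ (n - j) * g.
Proof.
elim: j => [_|j IHj ltjn]; first by exists 1; rewrite subn0 mulr1.
have [g eg] := IHj (ltnW ltjn).
exists (f^`() * (n - j)%:R * g + f * g^`()).
rewrite derivnS eg derivM deriv_exp -(subnSK ltjn) succnK exprSr -mulr_natr.
move: (f ^+ _) (_%:R) => F k; ring.
Qed.

Lemma legendre_orth n q : (size q <= n)%N -> pint (-1) 1 (legendre R n * q) = 0.
Proof.
move=> szq; rewrite /legendre -scalerAl pintZ ?ltN11R //.
rewrite pint_derivn_orth ?ltN11R ?mulr0 // => j ltjn.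
have [g ->] := derivn_exp_dvd ('X^2 - 1) (ltnW ltjn).
rewrite !hornerM !horner_exp !sqrX_sub1_end ?sqrrN ?expr1n //.
by rewrite !expr0n subn_eq0 leqNgt ltjn !mul0r.
Qed.

Lemma size_legendre n : size (legendre R n) = n.+1.
Proof.
rewrite /legendre size_scale; last first.
  by rewrite invr_eq0 mulf_neq0 ?expf_neq0 ?pnatr_eq0 -?lt0n ?fact_gt0.
rewrite cauchyreals.size_derivn.
have := size_exp ('X^2 - 1 : {poly R}) n; rewrite size_sqrX_sub1 /=.
have : ('X^2 - 1 : {poly R}) ^+ n != 0.
  by rewrite expf_neq0 // -size_poly_eq0 size_sqrX_sub1.
rewrite -size_poly_gt0; case: (size _) => // m _ /= ->.
by rewrite mul2n -addnn subSn ?leq_addr // addnK.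
Qed.

(** Integration by parts trades the derivative of the Legendre polynomial for
    the derivative of ('X^2 - 1) * q, which still has lower degree; the factor
    'X^2 - 1 kills the boundary terms. *)
Lemma legendre_deriv_orth n q : (size q < n)%N ->
  pint (-1) 1 ((legendre R n)^`() * ('X^2 - 1) * q) = 0.
Proof.
move=> szq; rewrite -mulrA pint_by_parts ?ltN11R //.
rewrite !hornerM !sqrX_sub1_end ?sqrrN ?expr1n // !(mul0r, mulr0) subrr sub0r.
rewrite legendre_orth ?oppr0 //.
rewrite polyorder.size_deriv.
have [->|q_neq0] := eqVneq q 0; first by rewrite mulr0 size_poly0.
rewrite size_mul // -?size_poly_eq0 ?size_sqrX_sub1 //.
Qed.

End Legendre.

(** * Quadrature on the reference interval *)

Lemma eq_lagrange (K : fieldType) n (x y : nat -> K) :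
  (forall k : 'I_n, x k = y k) -> lagrange n x = lagrange n y.
Proof.
move=> eq_xy; apply/eq_from_tnth => k.
rewrite /lagrange !locked_withE !tnth_map !tnth_ord_tuple eq_xy.
by under eq_bigr do rewrite eq_xy.
Qed.

Section Quadrature.
Variables (R : realType) (p : nat) (xt : nat -> R).
Hypothesis xt_lt : forall i j : nat, (i < j <= p)%N -> xt i < xt j.
Implicit Types (f g q : {poly R}) (i j k : 'I_p.+1).

Local Notation w := (@quad_weight R p xt).
Local Notation lag k := (tnth (lagrange p.+1 xt) k : {poly R}).

(** The Lagrange basis is a function of the first p + 1 nodes only, so the
    nodes may be continued to an injective sequence. *)
Lemma lagrange_injective_nodes : exists2 yt : nat -> R, injective yt &
  (forall k, yt k = xt k) /\ lagrange p.+1 yt = lagrange p.+1 xt.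
Proof.
pose yt m := if (m <= p)%N then xt m else xt p + (m - p)%:R.
have yt_lt m n : (m < n)%N -> yt m < yt n.
  rewrite /yt => ltmn; case: (leqP n p) => [le_np|lt_pn].
    by rewrite (leq_trans (ltnW ltmn) le_np) xt_lt ?ltmn.
  have pos : 0 < (n - p)%:R :> R by rewrite ltr0n subn_gt0.
  case: (leqP m p) => [le_mp|lt_pm]; last first.
    by rewrite ltrD2l ltr_nat ltn_sub2r.
  rewrite (le_lt_trans _ (_ : xt p < _)) ?ltrDl //.
  move: le_mp; rewrite leq_eqVlt => /predU1P[->//|lt_mp].
  by rewrite ltW ?xt_lt ?lt_mp /=.
have yt_xt k : yt k = xt k by rewrite /yt -ltnS ltn_ord.
exists yt; last split=> //.
  move=> m n eq_mn; have [lt_mn|lt_nm|//] := ltngtP m n.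
    by have := yt_lt _ _ lt_mn; rewrite eq_mn ltxx.
  by have := yt_lt _ _ lt_nm; rewrite eq_mn ltxx.
by apply: eq_lagrange => k; rewrite yt_xt.
Qed.

Lemma lagrange_interpolation q : (size q <= p.+1)%N ->
  q = \sum_(k < p.+1) q.[xt k] *: lag k.
Proof.
have [yt yt_inj [yt_xt eyt]] := lagrange_injective_nodes => szq.
rewrite [LHS](lagrange_gen (ltn0Sn p) yt_inj szq) eyt.
by apply: eq_bigr => k _; rewrite mul_polyC yt_xt.
Qed.

Lemma lagrange_node k j : (lag k).[xt j] = (k == j)%:R.
Proof.
have [yt yt_inj [yt_xt eyt]] := lagrange_injective_nodes.
by rewrite -eyt -yt_xt lagrange_sample.
Qed.

(** Division with remainder by the nodal polynomial P: the remainder is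
    integrated exactly by interpolation, while the multiple of P vanishes at the
    nodes and has zero integral as long as the quotient is orthogonal to P. *)
Lemma quad_exact (P : {poly R}) (m : nat) q : size P = p.+2 ->
  (forall k, root P (xt k)) ->
  (forall g, (size g <= m)%N -> pint (-1) 1 (P * g) = 0) ->
  (size q <= p.+1 + m)%N ->
  \sum_(k < p.+1) w k * q.[xt k] = pint (-1) 1 q.
Proof.
move=> szP rootP orthP szq.
have P_neq0 : P != 0 by rewrite -size_poly_eq0 szP.
have qE := divp_eq q P; set r := q %% P in qE.
have szr : (size r <= p.+1)%N by rewrite -ltnS -szP ltn_modp.
have qr k : q.[xt k] = r.[xt k].
  by rewrite qE hornerD hornerM (eqP (rootP k)) mulr0 add0r.
rewrite [in RHS]qE pintD ?ltN11R // mulrC orthP ?add0r; last first.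
  by rewrite size_divp // szP leq_subLR.
rewrite [in RHS](lagrange_interpolation szr) pint_sum ?ltN11R //.
by apply: eq_bigr => k _; rewrite pintZ ?ltN11R // qr mulrC.
Qed.

(** A polynomial that is nonnegative, integrated exactly and supported on the
    single node k reads off the weight of k as a positive integral. *)
Lemma quad_weight_gt0_test k q :
  (\sum_(j < p.+1) w j * q.[xt j] = pint (-1) 1 q) ->
  (forall y, -1 <= y <= 1 -> 0 <= q.[y]) ->
  0 < q.[xt k] -> (forall j, j != k -> q.[xt j] = 0) -> 0 < w k.
Proof.
move=> exq q_ge0 qk_gt0 q_nodes.
have q_neq0 : q != 0 by apply: contraTneq qk_gt0 => ->; rewrite horner0 ltxx.
have := pint_gt0 (ltN11R R) q_neq0 q_ge0.
rewrite -exq (bigD1 k) //= big1 ?addr0 ?pmulr_lgt0 // => j jk.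
by rewrite q_nodes // mulr0.
Qed.

End Quadrature.

Lemma gauss_legendre_weight_gt0 (R : realType) p (xt : nat -> R) :
  gauss_legendre_nodes p xt -> forall k : 'I_p.+1, 0 < quad_weight xt k.
Proof.
move=> [xt_lt xt_root] k.
set l : {poly R} := tnth (lagrange p.+1 xt) k.
apply: (@quad_weight_gt0_test _ _ _ _ (l ^+ 2)).
- apply: (quad_exact xt_lt (P := legendre R p.+1) (m := p.+1)).
  + by rewrite size_legendre.
  + by move=> j; apply: xt_root; rewrite -ltnS.
  + by move=> g; exact: legendre_orth.
  + have szl : (size l <= p.+1)%N by exact: size_npoly.
    rewrite (leq_trans (size_polyMleq _ _)) //.
    by rewrite (leq_trans (leq_pred _)) // leq_add.
- by move=> y _; rewrite horner_exp sqr_ge0.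
- by rewrite horner_exp (lagrange_node xt_lt) eqxx expr1n ltr01.
- by move=> j jk; rewrite horner_exp (lagrange_node xt_lt) eq_sym (negPf jk) expr0n.
Qed.

(** The squared Lagrange polynomial has one degree too many for exactness at
    the Lobatto nodes.  The test polynomial squares only its interior factors,
    and takes the factors of the end points, up to sign, to the first power. *)
Lemma gauss_lobatto_weight_gt0 (R : realType) p (xt : nat -> R) :
  gauss_lobatto_nodes p xt -> forall k : 'I_p.+1, 0 < quad_weight xt k.
Proof.
move=> [p_gt0 xt_lt xt0 xtp xt_root] k.
pose rs := rem (k : nat) (iota 1 p.-1).
pose g : {poly R} := \prod_(j <- rs) ('X - (xt j)%:P).
pose s : {poly R} := (if k == 0%N :> nat then 1 else 1 + 'X) *
                     (if k == p :> nat then 1 else 1 - 'X).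
have rsE j : (j \in rs) = (j != k) && (0 < j < p)%N.
  by rewrite mem_rem_uniq ?iota_uniq // inE mem_iota add1n prednK.
have szg : size g = (size rs).+1 by rewrite size_prod_XsubC.
apply: (@quad_weight_gt0_test _ _ _ _ (s * g ^+ 2)).
- apply: (quad_exact xt_lt (P := (legendre R p)^`() * ('X^2 - 1)) (m := p.-1)).
  + rewrite size_mul ?size_sqrX_sub1 -?size_poly_eq0 ?size_sqrX_sub1 //;
    by rewrite polyorder.size_deriv size_legendre /= ?addn3 // -lt0n.
  + move=> j; rewrite rootM; have := ltn_ord j; rewrite ltnS leq_eqVlt.
    case/predU1P=> [->|ltjp].
      by rewrite xtp [X in _ || X]rootE sqrX_sub1_end ?expr1n // eqxx orbT.
    have [->|j_gt0] := posnP j.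
      by rewrite xt0 [X in _ || X]rootE sqrX_sub1_end ?sqrrN ?expr1n // eqxx orbT.
    by rewrite xt_root // j_gt0.
  + by move=> h szh; rewrite legendre_deriv_orth // -(prednK p_gt0) ltnS.
  + have szL : (size (1 + 'X : {poly R})%R <= 2)%N.
      by rewrite (leq_trans (size_polyD _ _)) // size_poly1 size_polyX.
    have szR : (size (1 - 'X : {poly R})%R <= 2)%N.
      by rewrite (leq_trans (size_polyD _ _)) // size_polyN size_poly1 size_polyX.
    have szs : (size s + (k == 0%N :> nat) + (k == p :> nat) <= 3)%N.
      have := size_polyMleq (if k == 0%N :> nat then 1 else 1 + 'X : {poly R})
                            (if k == p :> nat then 1 else 1 - 'X).
      by rewrite -/s; do 2!case: ifP => _; rewrite ?size_poly1; lia.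
    have szrs : (size rs + (0 < k < p)%N)%N = p.-1.
      rewrite /rs; case: (boolP (0 < k < p)%N) => kp.
        rewrite size_rem ?size_iota ?mem_iota; lia.
      rewrite rem_id ?size_iota ?mem_iota; lia.
    have := size_polyMleq s (g ^+ 2); have := size_polyMleq g g.
    rewrite -expr2 szg; have := ltn_ord k; lia.
- move=> y /andP[yl yr]; rewrite hornerM horner_exp mulr_ge0 ?sqr_ge0 //.
  by rewrite /s hornerM mulr_ge0 //; case: ifP; rewrite !hornerE // ?subr_ge0 //; lra.
- rewrite hornerM horner_exp mulr_gt0 //.
    rewrite /s hornerM mulr_gt0 //; case: eqP => [_|/eqP nek]; rewrite !hornerE //.
      by rewrite -ltrBlDl sub0r -xt0 xt_lt // lt0n nek -ltnS ltn_ord.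
    by rewrite subr_gt0 -xtp xt_lt // leqnn andbT ltn_neqAle nek -ltnS ltn_ord.
  rewrite lt_def sqr_ge0 andbT expf_neq0 //.
  rewrite horner_prod prodf_seq_neq0; apply/allP => j /[!rsE]/andP[jk /andP[_ jp]].
  rewrite hornerXsubC subr_eq0 /=.
  have [ltkj|ltjk|eqkj] := ltngtP (k : nat) j.
  - by rewrite lt_eqF // xt_lt // ltkj ltnW.
  - by rewrite gt_eqF // xt_lt // ltjk -ltnS ltn_ord.
  - by rewrite eqkj eqxx in jk.
- move=> j jk; rewrite hornerM horner_exp.
  have [j_in|] := boolP ((j : nat) \in rs).
    apply/eqP; rewrite mulf_eq0 expf_eq0 horner_prod prodf_seq_eq0 /=.
    by apply/orP; right; apply/hasP; exists (j : nat); rewrite // hornerXsubC subrr /=.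
  rewrite rsE jk /= => j_end; rewrite /s.
  have [j0|jp] : (j = 0%N :> nat) \/ (j = p :> nat) by have := ltn_ord j; lia.
    have /negPf -> : k != 0%N :> nat by rewrite -j0 (inj_eq val_inj) eq_sym.
    rewrite j0 xt0.
    by rewrite -polyC1 !(hornerM, hornerD, hornerX, hornerC) subrr !mul0r.
  have /negPf -> : k != p :> nat.
    by apply: contraNneq jk => kp; apply/eqP/val_inj; rewrite /= jp kp.
  rewrite jp xtp.
  by rewrite -polyC1 !(hornerM, hornerD, hornerN, hornerX, hornerC) subrr mulr0 mul0r.
Qed.

(** * Nodal norms on the cells *)

Lemma sum_cauchy_schwarz (R : rcfType) (I : Type) (r : seq I) (P : pred I)
    (m f g : I -> R) : (forall i, P i -> 0 <= m i) ->
  `|\sum_(i <- r | P i) m i * (f i * g i)| <=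
  Num.sqrt (\sum_(i <- r | P i) m i * f i ^+ 2) *
  Num.sqrt (\sum_(i <- r | P i) m i * g i ^+ 2).
Proof.
move=> m_ge0.
set S := \sum_(i <- r | P i) m i * (f i * g i).
set F := \sum_(i <- r | P i) m i * f i ^+ 2.
set G := \sum_(i <- r | P i) m i * g i ^+ 2.
suff [SFG F_ge0 G_ge0] : [/\ S ^+ 2 <= F * G, 0 <= F & 0 <= G].
  by rewrite -sqrtrM // -sqrtr_sqr ler_wsqrtr.
rewrite {}/S {}/F {}/G; elim/big_rec3: _ => [|i G F S Pi [SFG F_ge0 G_ge0]].
  by rewrite expr0n mulr0 lexx.
have mi := m_ge0 i Pi.
split; [|by apply: addr_ge0 => //; apply: mulr_ge0 => //; exact: sqr_ge0..].
have cross : S * (f i * g i) * 2 <= F * g i ^+ 2 + G * f i ^+ 2.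
  have rhs_ge0 : 0 <= F * g i ^+ 2 + G * f i ^+ 2.
    by apply: addr_ge0; apply: mulr_ge0 => //; exact: sqr_ge0.
  rewrite (le_trans (ler_norm _)) // -ler_sqr ?nnegrE // real_normK ?num_real //.
  have /(ler_wpM2r (sqr_ge0 (f i * g i))) := SFG.
  have := sqr_ge0 (F * g i ^+ 2 - G * f i ^+ 2).
  lra.
have := ler_wpM2l mi cross; lra.
Qed.

Section NodalNorm.
Variables (R : realType) (p : nat) (xt : nat -> R).
Hypothesis xt_lt : forall i j : nat, (i < j <= p)%N -> xt i < xt j.
Hypothesis w_gt0 : forall k : 'I_p.+1, 0 < quad_weight xt k.
Implicit Types (f g : {poly R}) (x : nat -> R).

Definition cell_inner x i f g : R :=
  \sum_(k < p.+1)
    quad_weight xt k * (f.[quad_point x xt i k] * g.[quad_point x xt i k]).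

Definition cell_norm x i f : R :=
  Num.sqrt (\sum_(k < p.+1) quad_weight xt k * f.[quad_point x xt i k] ^+ 2).

Lemma cell_norm_ge0 x i f : 0 <= cell_norm x i f.
Proof. exact: sqrtr_ge0. Qed.

(** The Lagrange basis is bounded on any bounded set, and positivity of the
    weights lets the nodal norm control each nodal value. *)
Lemma reference_eval_bound : exists2 K : R, 0 < K &
  forall (f : {poly R}) (y : R), (size f <= p.+1)%N -> -1 <= y <= 3 ->
  `|f.[y]| <= K * Num.sqrt (\sum_(k < p.+1) quad_weight xt k * f.[xt k] ^+ 2) /\
  `|f^`().[y]| <=
    K * Num.sqrt (\sum_(k < p.+1) quad_weight xt k * f.[xt k] ^+ 2).
Proof.
pose lag (k : 'I_p.+1) : {poly R} := tnth (lagrange p.+1 xt) k.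
pose M (k : 'I_p.+1) : R := `|sval (poly_itv_bound (lag k) (-1) 3)| +
             `|sval (poly_itv_bound (lag k)^`() (-1) 3)|.
pose s (k : 'I_p.+1) : R := Num.sqrt (quad_weight xt k).
have s_gt0 k : 0 < s k by rewrite sqrtr_gt0.
exists (1 + \sum_(k < p.+1) M k / s k).
  by rewrite ltr_wpDr // sumr_ge0 // => k _; rewrite mulr_ge0 ?addr_ge0 ?invr_ge0 // ltW.
move=> f y szf y_in; set N : R := Num.sqrt _.
have N_ge0 : 0 <= N by exact: sqrtr_ge0.
have fk (k : 'I_p.+1) : `|f.[xt k]| <= N / s k.
  rewrite ler_pdivlMr // -sqrtr_sqr -sqrtrM ?sqr_ge0 // ler_wsqrtr //.
  rewrite (bigD1 k) //= mulrC lerDl sumr_ge0 // => j _.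
  by rewrite mulr_ge0 ?sqr_ge0 // ltW.
have sum_le (b : 'I_p.+1 -> R) : (forall k, `|b k| <= M k) ->
  `|\sum_(k < p.+1) f.[xt k] * b k| <= (1 + \sum_(k < p.+1) M k / s k) * N.
  move=> b_le; rewrite (le_trans (ler_norm_sum _ _ _)) //.
  rewrite mulrDl mul1r ler_wpDl // mulr_suml ler_sum // => k _.
  rewrite normrM (le_trans (ler_pM _ _ (fk k) (b_le k))) //.
  by rewrite mulrC mulrA mulrAC.
rewrite (lagrange_interpolation xt_lt szf); split.
  rewrite horner_sum; under eq_bigr do rewrite hornerZ.
  apply: sum_le => k; rewrite /M.
  case: poly_itv_bound => B /= /(_ y y_in) leB.
  by rewrite (le_trans leB) // (le_trans (ler_norm _)) // lerDl.
rewrite raddf_sum horner_sum /=; under eq_bigr do rewrite derivZ hornerZ.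
apply: sum_le => k; rewrite /M.
case: (poly_itv_bound (lag k)^`()) => B /= /(_ y y_in) leB.
by rewrite (le_trans leB) // (le_trans (ler_norm _)) // lerDr.
Qed.

(** The affine image of the reference bound.  The evaluation point may leave the
    cell to the right by one cell width: this is what the extension into a
    smaller neighbour needs. *)
Lemma cell_eval_bound : exists2 K : R, 0 < K &
  forall x i f (y : R), x i < x i.+1 -> (size f <= p.+1)%N ->
  x i <= y <= x i.+1 + cell_size x i ->
  `|f.[y]| <= K * cell_norm x i f /\
  `|f^`().[y]| <= K / cell_size x i * cell_norm x i f.
Proof.
have [K K_gt0 KP] := reference_eval_bound.
(* The factor 2 comes from the slope 2 / h of the map to [-1, 1]. *)
exists (K * 2) => [|x i f y ltx szf /andP[yl yr]]; first by rewrite mulr_gt0.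
pose h := cell_size x i; have h_gt0 : 0 < h by rewrite subr_gt0.
have xiS : x i.+1 = x i + h by rewrite /h /cell_size; ring.
pose A : {poly R} := (h / 2)%:P * 'X + ((x i + x i.+1) / 2)%:P.
have AE z : A.[z] = (x i + x i.+1) / 2 + h / 2 * z.
  by rewrite /A !hornerE addrC.
have szfA : (size (f \Po A) <= p.+1)%N.
  apply: leq_trans (size_comp_poly_leq _ _) _.
  have szA : (size A <= 2)%N.
    rewrite (leq_trans (size_polyD _ _)) // geq_max.
    rewrite (leq_trans (size_polyC_leq1 _)) // andbT.
    by rewrite mul_polyC (leq_trans (size_scale_leq _ _)) // size_polyX.
  rewrite ltnS; case: (size f) (size A) szf szA => [|m] [|[|[|n]]] //=; lia.
pose z := (y - (x i + x i.+1) / 2) / (h / 2).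
have h2_neq0 : h / 2 != 0 by rewrite gt_eqF // divr_gt0.
have Az : A.[z] = y by rewrite AE /z [h / 2 * _]mulrC divfK // addrC subrK.
have z_in : -1 <= z <= 3.
  rewrite /z ler_pdivlMr ?divr_gt0 // ler_pdivrMr ?divr_gt0 //.
  move: yl yr; rewrite -/h xiS => yl yr; lra.
have [le1 le2] := KP _ _ szfA z_in.
have nodesE : Num.sqrt (\sum_(k < p.+1) quad_weight xt k * (f \Po A).[xt k] ^+ 2)
              = cell_norm x i f.
  by congr Num.sqrt; apply: eq_bigr => k _; rewrite horner_comp AE.
rewrite nodesE in le1 le2; rewrite horner_comp Az in le1.
have N_ge0 := cell_norm_ge0 x i f.
split; first by rewrite (le_trans le1) // ler_wpM2r // ler_peMr ?ltW // ltr1n.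
have A' : A^`() = (h / 2)%:P by rewrite /A derivD derivM !derivC derivX; ring.
move: le2; rewrite deriv_comp A' hornerM horner_comp hornerC Az normrM.
rewrite [`|h / 2|]gtr0_norm ?divr_gt0 // -ler_pdivlMr ?divr_gt0 // => /le_trans-> //.
by rewrite -/h invfM invrK le_eqVlt; apply/orP; left; apply/eqP; ring.
Qed.

End NodalNorm.

(** * The discrete inner product *)

Section DiscreteInner.
Variables (R : realType) (p N : nat) (xt x : nat -> R).
Hypothesis w_gt0 : forall k : 'I_p.+1, 0 < quad_weight xt k.
Hypothesis x_lt : forall i : 'I_N, x i < x i.+1.
Implicit Types u v : dg_space R p N.

Lemma cell_size_gt0 (i : 'I_N) : 0 < cell_size x i.
Proof. by rewrite subr_gt0. Qed.

Lemma innerM_cells u v :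
  innerM x xt u v =
  \sum_(i < N) cell_size x i / 2 * cell_inner p xt x i (u i) (v i).
Proof.
apply: eq_bigr => i _; congr (_ * _).
by apply: eq_bigr => k _; rewrite mulrA.
Qed.

Lemma cell_inner_le (i : nat) (f g : {poly R}) :
  `|cell_inner p xt x i f g| <= cell_norm p xt x i f * cell_norm p xt x i g.
Proof. by apply: sum_cauchy_schwarz => k _; rewrite ltW. Qed.

Lemma cell_norm_sqr (i : nat) (f : {poly R}) :
  cell_norm p xt x i f ^+ 2 = cell_inner p xt x i f f.
Proof.
rewrite sqr_sqrtr.
  by apply: eq_bigr => k _; rewrite expr2.
by apply: sumr_ge0 => k _; rewrite mulr_ge0 ?sqr_ge0 // ltW.
Qed.

Lemma innerM_self u :
  innerM x xt u u =
  \sum_(i < N) cell_size x i / 2 * cell_norm p xt x i (u i) ^+ 2.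
Proof. by rewrite innerM_cells; under [RHS]eq_bigr do rewrite cell_norm_sqr. Qed.

Lemma innerM_ge0 u : 0 <= innerM x xt u u.
Proof.
rewrite innerM_self sumr_ge0 // => i _.
by rewrite mulr_ge0 ?sqr_ge0 // divr_ge0 // ltW // cell_size_gt0.
Qed.

Lemma normM_sqr u : normM x xt u ^+ 2 = innerM x xt u u.
Proof. by rewrite sqr_sqrtr // innerM_ge0. Qed.

Lemma innerM_cauchy_schwarz u v :
  `|innerM x xt u v| <= normM x xt u * normM x xt v.
Proof.
have h_ge0 (i : 'I_N) : 0 <= cell_size x i / 2.
  by rewrite divr_ge0 // ltW // cell_size_gt0.
rewrite /normM !innerM_self innerM_cells.
apply: le_trans (ler_norm_sum _ _ _) _.
have le_cell (i : 'I_N) : true ->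
    `|cell_size x i / 2 * cell_inner p xt x i (u i) (v i)| <=
    cell_size x i / 2 * (cell_norm p xt x i (u i) * cell_norm p xt x i (v i)).
  by move=> _; rewrite normrM (ger0_norm (h_ge0 i)) ler_wpM2l // cell_inner_le.
apply: le_trans (ler_sum _ le_cell) _.
apply: le_trans (ler_norm _) _.
exact: sum_cauchy_schwarz.
Qed.

(** A bound on the form that represents an operator bounds the operator: test
    with v = L u. *)
Lemma operator_bound (L : dg_space R p N -> dg_space R p N) (M : R) : 0 <= M ->
  (forall u v, `|innerM x xt (L u) v| <= M * (normM x xt u * normM x xt v)) ->
  forall u, normM x xt (L u) <= M * normM x xt u.
Proof.
move=> M_ge0 le_form u.
have := le_trans (ler_norm _) (le_form u (L u)); rewrite -normM_sqr expr2 mulrA.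
have : 0 <= normM x xt (L u) by exact: sqrtr_ge0.
rewrite le_eqVlt => /predU1P[<- _|Lu_gt0]; last by rewrite ler_pM2r.
by rewrite mulr_ge0 // sqrtr_ge0.
Qed.

End DiscreteInner.

(** * The stabilized form *)

Lemma ordS_neq N (c : 'I_N) : (1 < N)%N -> ordS c != c.
Proof.
move=> N_gt1; apply/eqP => /(congr1 val) /= eqc.
have := ltn_ord c; rewrite leq_eqVlt => /predU1P[cN|ltcN].
  by move: eqc; rewrite cN modnn => c0; move: cN N_gt1; rewrite -c0; lia.
by move: eqc; rewrite modn_small //; lia.
Qed.

Section StabilizedForm.
Variables (R : realType) (p N : nat) (x : nat -> R).
Hypothesis x_lt : forall i : 'I_N, x i < x i.+1.
Implicit Types u v : dg_space R p N.

(** Contribution of cell i to the background form, for unit velocity. *)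
Definition cell_flux u v (i : 'I_N) : R :=
  - pint (x i) (x i.+1) ((u i : {poly R}) * (v i)^`()) + (u i).[x i.+1] * jump x v i.

Lemma a_hE (a : R) u v : a_h x a u v = a * \sum_(i < N) cell_flux u v i.
Proof.
rewrite /a_h big_split /= mulrDr sumrN mulrN !mulr_sumr; congr (- _ + _).
  apply: eq_bigr => i _; congr (a * integ _ _ _).
  by apply/funext => y; rewrite hornerM.
by apply: eq_bigr => i _; rewrite mulrA.
Qed.

(** The stabilization form with its factor eta replaced by 1, for unit
    velocity. *)
Definition dod_term (c : 'I_N) u v : R :=
  ((extension x c u).[x c.+1] - (u c).[x c.+1]) * jump x v c +
  pint (x c) (x c.+1)
    ((extension x c u - (u c : {poly R})) * (extension x c v - (v c : {poly R}))^`()).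

Lemma J_hE (c : 'I_N) (a alpha lambda : R) u v :
  J_h x c a alpha lambda u v = a * (dod_eta alpha lambda * dod_term c u v).
Proof.
rewrite /J_h; have -> : J_h1 x c a alpha lambda u v = a * (dod_eta alpha lambda *
    pint (x c) (x c.+1)
      ((extension x c u - (u c : {poly R})) * (extension x c v - (v c : {poly R}))^`())).
  rewrite mulrCA -pintZ //; congr (_ * integ _ _ _).
  by apply/funext => y; rewrite hornerZ hornerM hornerD hornerN mulrA.
by rewrite /J_h0 /dod_term; ring.
Qed.

Lemma extension_left (c : 'I_N) u :
  (extension x c u).[x c] = (u (ord_pred c)).[x (ord_pred c).+1].
Proof. by rewrite horner_comp hornerD hornerX hornerC addrC subrK. Qed.

(** At full strength, integration by parts of the extension over the cut cell
    removes every boundary value of the test function on the cut cell, and moves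
    the derivative onto the extension, whose slope is governed by the large
    neighbour. *)
Lemma stabilized_cut_flux (c : 'I_N) u v :
  cell_flux u v (ord_pred c) + cell_flux u v c + dod_term c u v =
  - pint (x (ord_pred c)) (x (ord_pred c).+1)
      ((u (ord_pred c) : {poly R}) * (v (ord_pred c))^`())
  + (u (ord_pred c)).[x (ord_pred c).+1] * (v (ord_pred c)).[x (ord_pred c).+1]
  + pint (x c) (x c.+1) ((extension x c u)^`() * (v c : {poly R}))
  + pint (x c) (x c.+1) ((extension x c u - (u c : {poly R})) * (extension x c v)^`())
  - (extension x c u).[x c.+1] * (v (ordS c)).[x (ordS c)].
Proof.
rewrite /cell_flux /dod_term /jump ord_predK pint_by_parts // extension_left.
set U := extension x c u; set V := extension x c v.
have -> : (U - (u c : {poly R})) * (V - (v c : {poly R}))^`() =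
    (U - (u c : {poly R})) * V^`() - U * (v c)^`() + (u c : {poly R}) * (v c)^`().
  by rewrite derivB; ring.
by rewrite pintD // pintB //; ring.
Qed.

End StabilizedForm.

(** * The bound on the stabilized form *)

Section FormBound.
Variables (R : realType) (p N : nat) (xt x : nat -> R) (K : R).
Hypothesis eval_bound : forall i (f : {poly R}) (y : R), x i < x i.+1 ->
  (size f <= p.+1)%N -> x i <= y <= x i.+1 + cell_size x i ->
  `|f.[y]| <= K * cell_norm p xt x i f /\
  `|f^`().[y]| <= K / cell_size x i * cell_norm p xt x i f.
Hypothesis x_lt : forall i : 'I_N, x i < x i.+1.
Implicit Types u v : dg_space R p N.

Local Notation nrm u i := (cell_norm p xt x (nat_of_ord i) (u i : {poly R})).

Lemma dg_eval_bound u (i : 'I_N) y :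
  x i <= y <= x i.+1 + cell_size x i ->
  `|(u i).[y]| <= K * nrm u i /\
  `|(u i : {poly R})^`().[y]| <= K / cell_size x i * nrm u i.
Proof. by move=> y_in; apply: eval_bound; rewrite ?size_npoly. Qed.

Lemma in_cell_wide (i : 'I_N) y :
  x i <= y <= x i.+1 -> x i <= y <= x i.+1 + cell_size x i.
Proof.
by case/andP=> -> yr; rewrite (le_trans yr) // lerDl ltW // cell_size_gt0.
Qed.

Lemma trace_left u (i : 'I_N) : `|(u i).[x i]| <= K * nrm u i.
Proof. by have [] := @dg_eval_bound u i (x i); rewrite // in_cell_wide ?lexx ?ltW /=. Qed.

Lemma trace_right u (i : 'I_N) : `|(u i).[x i.+1]| <= K * nrm u i.
Proof.
by have [] := @dg_eval_bound u i (x i.+1); rewrite // in_cell_wide ?lexx ?ltW /=.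
Qed.

Lemma norm_pintM_le (i : 'I_N) (f g : {poly R}) (A B : R) :
  (forall y, x i <= y <= x i.+1 -> `|f.[y]| <= A) ->
  (forall y, x i <= y <= x i.+1 -> `|g.[y]| <= B) ->
  `|pint (x i) (x i.+1) (f * g)| <= A * B * cell_size x i.
Proof.
move=> leA leB; apply: norm_pint_le => // y y_in.
by rewrite hornerM normrM ler_pM ?leA ?leB.
Qed.

Lemma cell_integral_le u v (i : 'I_N) :
  `|pint (x i) (x i.+1) ((u i : {poly R}) * (v i)^`())| <=
  K ^+ 2 * (nrm u i * nrm v i).
Proof.
have h_gt0 := cell_size_gt0 x_lt i.
have := @norm_pintM_le i (u i) (v i)^`() (K * nrm u i)
   (K / cell_size x i * nrm v i).
have -> : K * nrm u i * (K / cell_size x i * nrm v i) * cell_size x i =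
          K ^+ 2 * (nrm u i * nrm v i) by field; rewrite gt_eqF.
by apply=> y /in_cell_wide y_in; have [] := dg_eval_bound u y_in;
   have [] := dg_eval_bound v y_in.
Qed.

Lemma trace_product_le (s t A B : R) :
  `|s| <= K * A -> `|t| <= K * B -> `|s * t| <= K ^+ 2 * (A * B).
Proof.
move=> leA leB; rewrite normrM (_ : K ^+ 2 * _ = (K * A) * (K * B)); last by ring.
by rewrite ler_pM.
Qed.

Lemma cell_flux_le u v (i : 'I_N) :
  `|cell_flux x u v i| <=
  K ^+ 2 * (2 * (nrm u i * nrm v i) + nrm u i * nrm v (ordS i)).
Proof.
have I := cell_integral_le u v i.
have Tr := trace_product_le (trace_right u i) (trace_right v i).
have Tl := trace_product_le (trace_right u i) (trace_left v (ordS i)).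
rewrite /cell_flux /jump mulrBr.
apply: le_trans (ler_normD _ _) _; rewrite normrN.
by have := ler_normB ((u i).[x i.+1] * (v i).[x i.+1])
  ((u i).[x i.+1] * (v (ordS i)).[x (ordS i)]); lra.
Qed.

Variable c : 'I_N.
Hypothesis cut_small : cell_size x c <= cell_size x (ord_pred c).

Lemma extension_bound u y : x c <= y <= x c.+1 ->
  `|(extension x c u).[y]| <= K * nrm u (ord_pred c) /\
  `|(extension x c u)^`().[y]| <=
    K / cell_size x (ord_pred c) * nrm u (ord_pred c).
Proof.
move=> /andP[yl yr]; rewrite /extension deriv_comp derivD derivX derivC addr0.
rewrite mulr1 !horner_comp hornerD hornerX hornerC.
apply: dg_eval_bound; move: cut_small; have := x_lt (ord_pred c).
rewrite /cell_size => pred_lt small; apply/andP; split; lra.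
Qed.

Local Notation rho := (cell_size x c / cell_size x (ord_pred c)).

Lemma full_stabilization_le u v :
  `|cell_flux x u v (ord_pred c) + cell_flux x u v c + dod_term x c u v| <=
  K ^+ 2 * ((2 + rho) * (nrm u (ord_pred c) * nrm v (ord_pred c))
            + rho * (nrm u (ord_pred c) * nrm v c)
            + rho * (nrm u c * nrm v (ord_pred c))
            + nrm u (ord_pred c) * nrm v (ordS c)).
Proof.
rewrite stabilized_cut_flux //; set b := ord_pred c.
have hb_gt0 := cell_size_gt0 x_lt b.
have I1 := cell_integral_le u v b.
have T1 := trace_product_le (trace_right u b) (trace_right v b).
have xr_in : x c <= x c.+1 <= x c.+1 by rewrite lexx ltW /=.
have T2 := trace_product_le (extension_bound u xr_in).1 (trace_left v (ordS c)).
have I2 : `|pint (x c) (x c.+1) ((extension x c u)^`() * (v c : {poly R}))| <=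
          K ^+ 2 * (rho * (nrm u b * nrm v c)).
  have := @norm_pintM_le c (extension x c u)^`() (v c)
     (K / cell_size x b * nrm u b) (K * nrm v c).
  have -> : K / cell_size x b * nrm u b * (K * nrm v c) * cell_size x c =
     K ^+ 2 * (rho * (nrm u b * nrm v c)) by ring.
  apply=> y y_in; first exact: (extension_bound u y_in).2.
  exact: (dg_eval_bound v (in_cell_wide y_in)).1.
have I3 : `|pint (x c) (x c.+1) ((extension x c u - (u c : {poly R}))
                                   * (extension x c v)^`())| <=
          K ^+ 2 * (rho * (nrm u b * nrm v b) + rho * (nrm u c * nrm v b)).
  have := @norm_pintM_le c (extension x c u - (u c : {poly R}))
     (extension x c v)^`() (K * nrm u b + K * nrm u c)
     (K / cell_size x b * nrm v b).
  have -> : (K * nrm u b + K * nrm u c) * (K / cell_size x b * nrm v b)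
      * cell_size x c =
     K ^+ 2 * (rho * (nrm u b * nrm v b) + rho * (nrm u c * nrm v b)).
    by ring.
  apply=> y y_in; last exact: (extension_bound v y_in).2.
  rewrite hornerD hornerN (le_trans (ler_normB _ _)) // lerD //.
    exact: (extension_bound u y_in).1.
  exact: (dg_eval_bound u (in_cell_wide y_in)).1.
apply: le_trans (ler_normB _ _) _.
apply: le_trans (lerD (ler_normD _ _) (lexx _)) _.
apply: le_trans (lerD (lerD (ler_normD _ _) (lexx _)) (lexx _)) _.
apply: le_trans (lerD (lerD (lerD (ler_normD _ _) (lexx _)) (lexx _)) (lexx _)) _.
rewrite normrN; lra.
Qed.

End FormBound.

Section CutCellMesh.
Variables (R : realType) (p N : nat) (xt x : nat -> R) (c : 'I_N) (dx alpha : R).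
Hypothesis w_gt0 : forall k : 'I_p.+1, 0 < quad_weight xt k.
Hypothesis mesh : cut_cell_mesh x c dx alpha.
Implicit Types u v : dg_space R p N.

Local Notation nrm u i := (cell_norm p xt x (nat_of_ord i) (u i : {poly R})).

Lemma mesh_lt (i : 'I_N) : x i < x i.+1.
Proof. by case: mesh. Qed.

Lemma mesh_alpha_gt0 : 0 < alpha.
Proof. by case: mesh => _ _ /andP[]. Qed.

Lemma mesh_dx_gt0 : 0 < dx.
Proof.
have := cell_size_gt0 mesh_lt c; case: mesh => _ _ _ _ [-> _].
by rewrite pmulr_rgt0 // mesh_alpha_gt0.
Qed.

Lemma large_cell_size (i : 'I_N) : i != c -> dx / 2 <= cell_size x i.
Proof.
have dx_gt0 := mesh_dx_gt0; case: mesh => _ _ /andP[_ alpha_le] eq_dx [_ eqS] ic.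
have [->|iS] := eqVneq i (ordS c); last by rewrite eq_dx //; lra.
by rewrite eqS mulrC ler_pM2r //; lra.
Qed.

Lemma ord_pred_neq : ord_pred c != c.
Proof.
apply: contra_neq (@ordS_neq N c _) => [eqc|]; last by case: mesh.
by rewrite -{1}eqc ord_predK.
Qed.

Lemma cut_ratio_le : cell_size x c / cell_size x (ord_pred c) <= 2 * alpha.
Proof.
have h_gt0 := cell_size_gt0 mesh_lt (ord_pred c).
rewrite ler_pdivrMr //; have := large_cell_size ord_pred_neq.
case: mesh => _ _ _ _ [-> _] le_h.
by rewrite -mulrA mulrCA ler_pM2l ?mesh_alpha_gt0 //; lra.
Qed.

Lemma cut_cell_le_left : cell_size x c <= cell_size x (ord_pred c).
Proof.
have := large_cell_size ord_pred_neq; apply: le_trans.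
case: mesh => _ _ /andP[_ alpha_le] _ [-> _].
by rewrite mulrC ler_pM2l ?mesh_dx_gt0.
Qed.

(** The largest nodal norm that u can have on a cell of width at least dx / 2;
    on the cut cell the nodal norm may be larger by a factor
    1 / Num.sqrt alpha. *)
Definition nodal_scale u : R := 2 * normM x xt u / Num.sqrt dx.

Lemma nodal_scale_ge0 u : 0 <= nodal_scale u.
Proof. by rewrite /nodal_scale divr_ge0 ?sqrtr_ge0 // mulr_ge0 ?sqrtr_ge0. Qed.

Lemma nodal_scaleM u v :
  nodal_scale u * nodal_scale v = 4 / dx * (normM x xt u * normM x xt v).
Proof.
have s_gt0 : 0 < Num.sqrt dx by rewrite sqrtr_gt0 mesh_dx_gt0.
rewrite /nodal_scale -{3}(sqr_sqrtr (ltW mesh_dx_gt0)).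
by field; rewrite gt_eqF.
Qed.

Lemma large_cells_norm_le u :
  \sum_(i < N | i != c) nrm u i ^+ 2 <= nodal_scale u ^+ 2.
Proof.
have dx_gt0 := mesh_dx_gt0; have x_lt := mesh_lt.
rewrite expr2 nodal_scaleM -expr2 (normM_sqr w_gt0 x_lt) (innerM_self _ w_gt0).
rewrite mulr_sumr [leRHS](bigD1 c) //= ler_wpDl //.
  apply: mulr_ge0; first by rewrite divr_ge0 // ltW.
  by rewrite mulr_ge0 ?sqr_ge0 // divr_ge0 // ltW // cell_size_gt0.
apply: ler_sum => i ic; rewrite mulrA ler_peMl ?sqr_ge0 //.
rewrite -ler_pdivrMl ?divr_gt0 // mulr1 invf_div.
by have := large_cell_size ic; lra.
Qed.

Lemma large_cell_norm_le u (i : 'I_N) : i != c -> nrm u i <= nodal_scale u.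
Proof.
move=> ic; rewrite -ler_sqr ?nnegrE ?nodal_scale_ge0 ?cell_norm_ge0 //.
apply: le_trans (large_cells_norm_le u).
by rewrite (bigD1 i) //= lerDl sumr_ge0 // => j _; rewrite sqr_ge0.
Qed.

Lemma cut_cell_norm_le u : Num.sqrt alpha * nrm u c <= nodal_scale u.
Proof.
have dx_gt0 := mesh_dx_gt0; have x_lt := mesh_lt.
rewrite -ler_sqr ?nnegrE ?mulr_ge0 ?nodal_scale_ge0 ?cell_norm_ge0 ?sqrtr_ge0 //.
rewrite expr2 [leRHS]expr2 nodal_scaleM -!expr2 exprMn.
rewrite (sqr_sqrtr (ltW mesh_alpha_gt0)).
rewrite (normM_sqr w_gt0 x_lt) (innerM_self _ w_gt0) (bigD1 c) //= mulrDr.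
have rest_ge0 : 0 <= 4 / dx * \sum_(i < N | i != c) cell_size x i / 2 * nrm u i ^+ 2.
  rewrite mulr_ge0 ?divr_ge0 ?(ltW dx_gt0) // sumr_ge0 // => i _.
  by rewrite mulr_ge0 ?sqr_ge0 // divr_ge0 // ltW // cell_size_gt0.
apply: le_trans (lerD (lexx _) rest_ge0); rewrite addr0.
case: mesh => _ _ _ _ [-> _].
rewrite [leRHS](_ : _ = 2 * (alpha * nrm u c ^+ 2)); last first.
  by field; rewrite gt_eqF.
have := mulr_ge0 (ltW mesh_alpha_gt0) (sqr_ge0 (nrm u c)); lra.
Qed.

Variable K : R.
Hypothesis eval_bound : forall i (f : {poly R}) (y : R), x i < x i.+1 ->
  (size f <= p.+1)%N -> x i <= y <= x i.+1 + cell_size x i ->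
  `|f.[y]| <= K * cell_norm p xt x i f /\
  `|f^`().[y]| <= K / cell_size x i * cell_norm p xt x i f.

(** Away from the cut cell every cell is large, so the terms n_i m_i and
    n_i m_(i+1) sum up by the Cauchy-Schwarz inequality, without counting
    cells. *)
Lemma large_flux_le u v :
  `|\sum_(i < N | (i != c) && (i != ord_pred c)) cell_flux x u v i| <=
  3 * K ^+ 2 * (nodal_scale u * nodal_scale v).
Proof.
have cs (b : 'I_N -> 'I_N) (P : pred 'I_N) :
    (forall i, P i -> i != c) ->
    \sum_(i < N | P i) nrm v (b i) ^+ 2 <= nodal_scale v ^+ 2 ->
    \sum_(i < N | P i) nrm u i * nrm v (b i) <= nodal_scale u * nodal_scale v.
  move=> Pc vb_le.
  have := @sum_cauchy_schwarz _ _ (index_enum _) P (fun=> 1)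
    (fun i => nrm u i) (fun i => nrm v (b i)) (fun _ _ => ler01).
  have mul1 (F : 'I_N -> R) : \sum_(i < N | P i) 1 * F i = \sum_(i < N | P i) F i.
    by apply: eq_bigr => i _; rewrite mul1r.
  rewrite !mul1.
  move/(le_trans (ler_norm _))/le_trans; apply.
  have us := nodal_scale_ge0.
  rewrite ler_pM ?sqrtr_ge0 // -[leRHS]ger0_norm // -sqrtr_sqr ler_wsqrtr //.
  apply: le_trans (large_cells_norm_le u); rewrite [leRHS](bigID P) /=.
  rewrite [X in _ <= X + _](eq_bigl P); last first.
    by move=> i; case Pi: (P i); rewrite ?andbF // andbT Pc.
  by rewrite lerDl sumr_ge0 // => i _; rewrite sqr_ge0.
apply: le_trans (ler_norm_sum _ _ _) _.
have le_i (i : 'I_N) : (i != c) && (i != ord_pred c) -> `|cell_flux x u v i| <=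
    K ^+ 2 * (2 * (nrm u i * nrm v i) + nrm u i * nrm v (ordS i)).
  by move=> _; exact: (cell_flux_le eval_bound mesh_lt).
apply: le_trans (ler_sum _ le_i) _.
rewrite -mulr_sumr big_split /= -mulr_sumr.
set G := nodal_scale u * nodal_scale v.
rewrite (_ : 3 * K ^+ 2 * G = K ^+ 2 * (2 * G + G)); last by ring.
rewrite ler_wpM2l ?sqr_ge0 // lerD ?ler_pM2l //.
  apply: (cs id) => [i /andP[]//|]; apply: le_trans (large_cells_norm_le v).
  rewrite [leRHS](bigID (fun i => i != ord_pred c)) /= lerDl.
  by rewrite sumr_ge0 // => i _; rewrite sqr_ge0.
apply: (cs (@ordS N)) => [i /andP[]//|]; apply: le_trans (large_cells_norm_le v).
rewrite [leRHS](reindex _ (onW_bij _ (@ordS_bij N))) /=.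
rewrite [leRHS](bigID (fun i => i != c)) /=.
rewrite [X in _ <= X + _](eq_bigl (fun i => (i != c) && (i != ord_pred c))).
  by rewrite lerDl sumr_ge0 // => i _; rewrite sqr_ge0.
by move=> i /=; rewrite andbC (can2_eq (@ordSK N) (@ord_predK N)).
Qed.

Variables (lambda0 lambda : R).
Hypothesis lambda0_gt0 : 0 < lambda0.
Hypothesis lambda_ge : lambda0 <= lambda.

(** Near the cut cell the form is the convex combination, with weight 1 - eta,
    of the background form, whose cut-cell terms are too large by a factor
    1 / alpha, and of the fully stabilized one.  The weight is at most
    alpha / lambda0, which makes up for that factor. *)
Lemma cut_flux_le u v :
  `|cell_flux x u v (ord_pred c) + cell_flux x u v c +
    dod_eta alpha lambda * dod_term x c u v| <=
  (11 + 4 / lambda0) * K ^+ 2 * (nodal_scale u * nodal_scale v).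
Proof.
have lambda_gt0 := lt_le_trans lambda0_gt0 lambda_ge.
have alpha_gt0 := mesh_alpha_gt0.
have alpha_le1 : alpha <= 1 by case: mesh => _ _ /andP[_ le2] _ _; lra.
set eta := dod_eta alpha lambda; pose theta := 1 - eta.
set G := nodal_scale u * nodal_scale v.
set nb := nrm u (ord_pred c); set nc := nrm u c.
set mb := nrm v (ord_pred c); set mc := nrm v c; set ms := nrm v (ordS c).
have thetaE : theta = Num.min 1 (alpha / lambda).
  by rewrite /theta /eta /dod_eta opprB addrCA subrr addr0.
have theta_ge0 : 0 <= theta.
  by rewrite thetaE le_min ler01 divr_ge0 // ltW.
have theta_le1 : theta <= 1 by rewrite thetaE ge_min lexx.
have theta_le : theta <= alpha * lambda0^-1.
  rewrite thetaE ge_min ler_pM2l // lef_pV2 ?posrE // lambda_ge orbT //.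
have S_neq : ordS c != c by apply: ordS_neq; case: mesh.
have nb_ge0 : 0 <= nb := cell_norm_ge0 _ _ _ _ _.
have nc_ge0 : 0 <= nc := cell_norm_ge0 _ _ _ _ _.
have mb_ge0 : 0 <= mb := cell_norm_ge0 _ _ _ _ _.
have mc_ge0 : 0 <= mc := cell_norm_ge0 _ _ _ _ _.
have ms_ge0 : 0 <= ms := cell_norm_ge0 _ _ _ _ _.
have nb_le : nb <= nodal_scale u := large_cell_norm_le u ord_pred_neq.
have mb_le : mb <= nodal_scale v := large_cell_norm_le v ord_pred_neq.
have ms_le : ms <= nodal_scale v := large_cell_norm_le v S_neq.
have s_ge0 : 0 <= Num.sqrt alpha := sqrtr_ge0 _.
have s_le1 : Num.sqrt alpha <= 1 by rewrite -sqrtr1 ler_wsqrtr.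
have nc_le : Num.sqrt alpha * nc <= nodal_scale u := cut_cell_norm_le u.
have mc_le : Num.sqrt alpha * mc <= nodal_scale v := cut_cell_norm_le v.
have alphaE : alpha = Num.sqrt alpha * Num.sqrt alpha.
  by rewrite -expr2 sqr_sqrtr // ltW.
(* A nodal norm on the cut cell is paid for by one factor sqrt alpha, so any
   product of two nodal norms becomes harmless after multiplication by alpha. *)
have sM (s : R) : 0 <= s -> Num.sqrt alpha * s <= s.
  by move=> s_ge; rewrite ler_piMl.
have nbmb : nb * mb <= G by rewrite ler_pM.
have nbms : nb * ms <= G by rewrite ler_pM.
have nbmc : alpha * (nb * mc) <= G.
  rewrite {1}alphaE mulrACA ler_pM ?mulr_ge0 //.
  exact: le_trans (sM _ nb_ge0) nb_le.
have ncmb : alpha * (nc * mb) <= G.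
  rewrite {1}alphaE mulrACA ler_pM ?mulr_ge0 //.
  exact: le_trans (sM _ mb_ge0) mb_le.
have ncms : alpha * (nc * ms) <= G.
  rewrite {1}alphaE mulrACA ler_pM ?mulr_ge0 //.
  exact: le_trans (sM _ ms_ge0) ms_le.
have ncmc : alpha * (nc * mc) <= G.
  by rewrite {1}alphaE mulrACA ler_pM ?mulr_ge0.
have theta_small s : 0 <= s -> alpha * s <= G -> theta * s <= lambda0^-1 * G.
  move=> s_ge le_s; apply: le_trans (ler_wpM2r s_ge theta_le) _.
  by rewrite mulrAC mulrC ler_wpM2l // invr_ge0 ltW.
have theta_G s : 0 <= s -> s <= G -> theta * s <= G.
  by move=> s_ge le_s; apply: le_trans le_s; rewrite ler_piMl.
have G_ge0 : 0 <= G by rewrite mulr_ge0 ?nodal_scale_ge0.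
have Fb := cell_flux_le eval_bound mesh_lt u v (ord_pred c).
have Fc := cell_flux_le eval_bound mesh_lt u v c.
have Q := full_stabilization_le eval_bound mesh_lt cut_cell_le_left u v.
rewrite ord_predK -/nb -/mb -/mc in Fb; rewrite -/nc -/mc -/ms in Fc.
rewrite -/nb -/nc -/mb -/mc -/ms in Q.
(* The ratio rho of the cell sizes is itself of order alpha. *)
have rho_le := cut_ratio_le.
set rho := _ / _ in Q rho_le.
have Q' : (2 + rho) * (nb * mb) + rho * (nb * mc) + rho * (nc * mb) + nb * ms <= 9 * G.
  have rho_small s : 0 <= s -> alpha * s <= G -> rho * s <= 2 * G.
    move=> s_ge le_s; apply: le_trans (ler_wpM2r s_ge rho_le) _.
    by rewrite -mulrA ler_pM2l.
  have := rho_small _ (mulr_ge0 nb_ge0 mc_ge0) nbmc.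
  have := rho_small _ (mulr_ge0 nc_ge0 mb_ge0) ncmb.
  have : alpha * (nb * mb) <= G.
    by apply: le_trans nbmb; rewrite ler_piMl // mulr_ge0.
  move/(rho_small _ (mulr_ge0 nb_ge0 mb_ge0)); lra.
have K2 : 0 <= K ^+ 2 by exact: sqr_ge0.
have eta_le1 : `|eta| <= 1.
  have -> : eta = 1 - theta by rewrite /theta; ring.
  by rewrite ger0_norm; lra.
rewrite [X in `|X|](_ : _ = theta * cell_flux x u v (ord_pred c) +
   theta * cell_flux x u v c +
   eta * (cell_flux x u v (ord_pred c) + cell_flux x u v c + dod_term x c u v));
   last by rewrite /theta; ring.
apply: le_trans (ler_normD _ _) _.
apply: le_trans (lerD (ler_normD _ _) (lexx _)) _.
rewrite !normrM (ger0_norm theta_ge0).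
have B1 : theta * `|cell_flux x u v (ord_pred c)| <= K ^+ 2 * (2 * G + lambda0^-1 * G).
  apply: le_trans (ler_wpM2l theta_ge0 Fb) _; rewrite mulrCA ler_wpM2l //.
  have := theta_G _ (mulr_ge0 nb_ge0 mb_ge0) nbmb.
  have := theta_small _ (mulr_ge0 nb_ge0 mc_ge0) nbmc; lra.
have B2 : theta * `|cell_flux x u v c| <= K ^+ 2 * (3 * (lambda0^-1 * G)).
  apply: le_trans (ler_wpM2l theta_ge0 Fc) _; rewrite mulrCA ler_wpM2l //.
  have := theta_small _ (mulr_ge0 nc_ge0 mc_ge0) ncmc.
  have := theta_small _ (mulr_ge0 nc_ge0 ms_ge0) ncms; lra.
have B3 : `|eta| * `|cell_flux x u v (ord_pred c) + cell_flux x u v c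
                     + dod_term x c u v| <= K ^+ 2 * (9 * G).
  apply: le_trans (ler_piMl (normr_ge0 _) eta_le1) _.
  by apply: le_trans Q _; rewrite ler_wpM2l.
lra.
Qed.

Lemma dod_form_le (a : R) u v : 0 < a ->
  `|- a_h x a u v - J_h x c a alpha lambda u v| <=
  4 * (14 + 4 / lambda0) * K ^+ 2 * a / dx * (normM x xt u * normM x xt v).
Proof.
move=> a_gt0; rewrite a_hE (J_hE mesh_lt) -opprD normrN -mulrDr normrM gtr0_norm //.
rewrite (bigD1 c) //= (bigD1 (ord_pred c)) ?ord_pred_neq //=.
have := cut_flux_le u v; have := large_flux_le u v; rewrite nodal_scaleM.
set F1 := \sum_(i < N | _) _; set G := 4 / dx * _ => leF leC.
rewrite (_ : 4 * _ * _ * _ / dx * _ = a * ((14 + 4 / lambda0) * K ^+ 2 * G)); last first.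
  by rewrite /G; ring.
rewrite ler_pM2l // [X in `|X|](_ : _ = (cell_flux x u v (ord_pred c) +
  cell_flux x u v c + dod_eta alpha lambda * dod_term x c u v) + F1); last by ring.
apply: le_trans (ler_normD _ _) _; lra.
Qed.

End CutCellMesh.

(** * The operator norms *)

Lemma quad_nodes_regular (R : realType) p (xt : nat -> R) :
  gauss_legendre_nodes p xt \/ gauss_lobatto_nodes p xt ->
  (forall i j : nat, (i < j <= p)%N -> xt i < xt j) /\
  (forall k : 'I_p.+1, 0 < quad_weight xt k).
Proof.
case=> nodes; split.
- by case: nodes.
- exact: gauss_legendre_weight_gt0.
- by case: nodes.
- exact: gauss_lobatto_weight_gt0.
Qed.

(** The indicator of the cut cell is the witness that the background operator
    alone has a norm of order at least a / (alpha * dx). *)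
Section CutIndicator.
Variables (R : realType) (p N : nat) (xt x : nat -> R) (c : 'I_N).

Definition cut_indicator : dg_space R p N :=
  [ffun i => npolyp p.+1 (i == c)%:R%:P].

Lemma cut_indicatorE i : cut_indicator i = (i == c)%:R%:P :> {poly R}.
Proof. by rewrite ffunE npolypK // (leq_trans (size_polyC_leq1 _)). Qed.

Lemma innerM_cut_indicator :
  innerM x xt cut_indicator cut_indicator =
  cell_size x c / 2 * \sum_(k < p.+1) quad_weight xt k.
Proof.
rewrite /innerM (bigD1 c) //= [X in _ + X]big1 ?addr0 => [|i ic].
  congr (_ * _); apply: eq_bigr => k _.
  by rewrite cut_indicatorE eqxx hornerC !mulr1.
rewrite big1 ?mulr0 // => k _.
by rewrite cut_indicatorE (negPf ic) hornerC !mulr0.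
Qed.

(** Everything that the cut cell contains flows out through its right end. *)
Lemma a_h_cut_indicator (a : R) : (1 < N)%N -> (forall i : 'I_N, x i < x i.+1) ->
  a_h x a cut_indicator cut_indicator = a.
Proof.
move=> N_gt1 x_lt; rewrite a_hE (bigD1 c) //= big1 => [|i ic].
  rewrite /cell_flux /jump !cut_indicatorE derivC mulr0 pint0 // !hornerC eqxx.
  by rewrite (negPf (ordS_neq c N_gt1)) /= subr0 oppr0 add0r addr0 !mulr1.
rewrite /cell_flux /jump !cut_indicatorE derivC mulr0 pint0 // !hornerC.
by rewrite (negPf ic) oppr0 mul0r addr0.
Qed.

End CutIndicator.

Lemma normMZ (R : realType) (p N : nat) (xt x : nat -> R) (k : R)
    (u : dg_space R p N) :
  normM x xt (k *: u) = `|k| * normM x xt u.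
Proof.
rewrite /normM -sqrtr_sqr -sqrtrM ?sqr_ge0 //; congr Num.sqrt.
rewrite /innerM mulr_sumr; apply: eq_bigr => i _.
rewrite mulrCA; congr (_ * _); rewrite mulr_sumr; apply: eq_bigr => j _.
by rewrite ffunE /= hornerZ; ring.
Qed.

Theorem theorem2p3 (R : realType) (p : nat) (xt : nat -> R)
    (hxt : gauss_legendre_nodes p xt \/ gauss_lobatto_nodes p xt) :
  (forall lambda0 : R, 0 < lambda0 ->
   exists C : R,
     forall (N : nat) (x : nat -> R) (c : 'I_N) (dx alpha a lambda : R)
       (L : {linear dg_space R p N -> dg_space R p N}),
       cut_cell_mesh x c dx alpha -> 0 < a -> lambda0 <= lambda ->
       is_dod_operator x xt c a alpha lambda L ->
       (forall u : dg_space R p N,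
          normM x xt (L u) <= C * a / dx * normM x xt u) /\
       (opnormM x xt L <= (C * a / dx)%:E)%E)
  /\
  (exists C0 : R, 0 < C0 /\
     forall (N : nat) (x : nat -> R) (c : 'I_N) (dx alpha a : R)
       (L : {linear dg_space R p N -> dg_space R p N}),
       cut_cell_mesh x c dx alpha -> 0 < a ->
       is_unstabilized_operator x xt a L ->
       ((C0 * a / (alpha * dx))%:E <= opnormM x xt L)%E).
Proof.
have [xt_lt w_gt0] := quad_nodes_regular hxt.
split=> [lambda0 lambda0_gt0|].
  have [K K_gt0 eval_bound] := cell_eval_bound xt_lt w_gt0.
  exists (4 * (14 + 4 / lambda0) * K ^+ 2).
  move=> N x c dx alpha a lambda L mesh a_gt0 lambda_ge L_dod.
  have M_ge0 : 0 <= 4 * (14 + 4 / lambda0) * K ^+ 2 * a / dx.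
    have dx_gt0 := mesh_dx_gt0 mesh.
    have := divr_gt0 (ltr0n R 4) lambda0_gt0 => q_gt0.
    by rewrite divr_ge0 ?(ltW dx_gt0) // !mulr_ge0 ?sqr_ge0 ?(ltW a_gt0) //; lra.
  have L_bound u : normM x xt (L u) <=
      4 * (14 + 4 / lambda0) * K ^+ 2 * a / dx * normM x xt u.
    apply: (operator_bound w_gt0 (mesh_lt mesh) M_ge0) => {}u v.
    rewrite L_dod; exact: (dod_form_le w_gt0 mesh (eval_bound x)).
  split=> //; apply: ge_ereal_sup => _ [u /= u_le1 <-]; rewrite lee_fin.
  by apply: le_trans (L_bound u) _; rewrite ler_piMr.
set W := \sum_(k < p.+1) quad_weight xt k.
have W_gt0 : 0 < W.
  rewrite /W big_ord_recl ltr_pwDl ?w_gt0 // sumr_ge0 // => k _.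
  by rewrite ltW.
exists (2 / W); split=> [|N x c dx alpha a L mesh a_gt0 L_up].
  by rewrite divr_gt0.
have [N_gt1 x_lt _ _ [cut_size _]] := mesh.
have alpha_gt0 := mesh_alpha_gt0 mesh; have dx_gt0 := mesh_dx_gt0 mesh.
pose e := cut_indicator R p c.
have e_sqr : normM x xt e ^+ 2 = alpha * dx / 2 * W.
  by rewrite (normM_sqr w_gt0 x_lt) innerM_cut_indicator cut_size.
have e_gt0 : 0 < normM x xt e.
  by rewrite lt_def sqrtr_ge0 -sqrf_eq0 e_sqr gt_eqF // !mulr_gt0 ?invr_gt0.
have Le_ge : a <= normM x xt (L e) * normM x xt e.
  apply: le_trans (innerM_cauchy_schwarz w_gt0 x_lt (L e) e).
  by rewrite L_up a_h_cut_indicator // normrN gtr0_norm.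
apply: le_trans (ereal_sup_ubound _); last first.
  exists ((normM x xt e)^-1 *: e) => //=.
  by rewrite normMZ gtr0_norm ?invr_gt0 // mulVf ?gt_eqF.
rewrite lee_fin linearZ /= normMZ gtr0_norm ?invr_gt0 //.
rewrite ler_pdivlMl // -(ler_pM2r e_gt0); apply: le_trans Le_ge.
rewrite mulrAC -expr2 e_sqr le_eqVlt; apply/orP; left; apply/eqP.
by field; rewrite !gt_eqF.
Qed.
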